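(* For any $\varepsilon\in\mathbb C$ with $\varepsilon\ne0$, there is an isomorphism $\overline{\mathcal T}_n(\varepsilon)\cong\overline T_n$ between the fibre of $\overline{\mathcal T}_n\to\mathbb A^1$ over $\varepsilon$ and the Losev–Manin space, via the identification $\alpha_{ij}=1-\varepsilon\delta_{ij}=\dfrac{\nu_{ij}-\varepsilon}{\nu_{ij}}$ for all distinct $i,j\in[n]$.
   Context: $p([n])$ is the set of ordered pairs $ij$ of distinct elements of $[n]=\{1,\dots,n\}$. Equations between $\mathbb P^1$-valued coordinates are understood after homogenizing (clearing denominators); e.g. $ab=c$ means $a_1b_1c_2=c_1a_2b_2$ for $a=[a_1:a_2]$ etc. The Losev–Manin space (permutahedral toric variety) $\overline T_n$ is the subscheme of $\alpha\in(\mathbb P^1)^{p([n])}$ defined by $\alpha_{ij}\alpha_{jk}=\alpha_{ik}$ and $\alpha_{ij}\alpha_{ji}=1$ for distinct $i,j,k$. $\overline{\mathcal T}_n$ is the subscheme of $(\nu,\varepsilon)\in(\mathbb P^1)^{p([n])}\times\mathbb A^1$ (over $\mathbb C$) defined by $\varepsilon\nu_{ik}+\nu_{ij}\nu_{jk}=\nu_{ik}\nu_{jk}+\nu_{ij}\nu_{ik}$ and $\nu_{ij}+\nu_{ji}=\varepsilon$ for distinct $i,j,k$; with $\delta_{ij}=\nu_{ij}^{-1}$ the equations become $\varepsilon\delta_{ij}\delta_{jk}+\delta_{ik}=\delta_{ij}+\delta_{jk}$ and $\delta_{ij}+\delta_{ji}=\varepsilon\delta_{ij}\delta_{ji}$.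 *)

(* Defs.v *)
From HB Require Import structures.
From mathcomp Require Import all_boot all_algebra complex ring.
From mathcomp Require Import boolp classical_sets reals.

Set Implicit Arguments.
Unset Strict Implicit.
Unset Printing Implicit Defensive.
Import GRing.Theory.
Local Open Scope classical_set_scope.
Local Open Scope ring_scope.

(* Schemes over a field k are represented by their functors of points on
   commutative k-algebras.  Schemes embed fully faithfully in such functors, so
   an isomorphism of k-schemes is the same thing as a natural isomorphism.
   [comAlgType k] omits only the zero algebra, at which every scheme has exactly
   one point. *)
Record cfunctor (k : fieldType) := CFunctor {
  points :> comAlgType k -> Type;
  fmap : forall A B : comAlgType k, {lrmorphism A -> B} -> points A -> points B;
  fmap_id : forall (A : comAlgType k) (x : points A),
    fmap (@idfun A : {lrmorphism A -> A}) x = x;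
  fmap_comp : forall (A B D : comAlgType k) (f : {lrmorphism A -> B})
    (g : {lrmorphism B -> D}) (x : points A),
    fmap (g \o f : {lrmorphism A -> D}) x = fmap g (fmap f x)
}.
Arguments fmap {k} F {A B} f x : rename.

Record fmorphism (k : fieldType) (F G : cfunctor k) := FMorphism {
  app :> forall A : comAlgType k, F A -> G A;
  natural : forall (A B : comAlgType k) (f : {lrmorphism A -> B}) (x : F A),
    app (fmap F f x) = fmap G f (app x)
}.
Arguments app {k F G} h A x : rename.

Definition is_iso (k : fieldType) (F G : cfunctor k) (f : fmorphism F G) :
    Prop :=
  exists g : fmorphism G F,
    (forall A, cancel (f A) (g A)) /\ (forall A, cancel (g A) (f A)).

Section Constructions.
Variable k : fieldType.

Definition A1_map (A B : comAlgType k) (f : {lrmorphism A -> B}) (x : A) : B :=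
  f x.

Definition A1 : cfunctor k.
Proof.
by refine (@CFunctor k (fun A => A : Type) A1_map _ _).
Defined.

Definition prod_map (F G : cfunctor k) (A B : comAlgType k)
    (f : {lrmorphism A -> B}) (x : F A * G A) : F B * G B :=
  (fmap F f x.1, fmap G f x.2).

Definition fprodc (F G : cfunctor k) : cfunctor k.
Proof.
refine (@CFunctor k (fun A => (F A * G A)%type) (@prod_map F G) _ _).
- by move=> A [x y]; rewrite /prod_map /= !fmap_id.
- by move=> A B D f g [x y]; rewrite /prod_map /= !fmap_comp.
Defined.

Definition power_map (F : cfunctor k) (I : Type) (A B : comAlgType k)
    (f : {lrmorphism A -> B}) (x : I -> F A) : I -> F B :=
  fun i => fmap F f (x i).

Definition power (F : cfunctor k) (I : Type) : cfunctor k.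
Proof.
refine (@CFunctor k (fun A => I -> F A) (@power_map F I) _ _).
- by move=> A x; apply/funext => i; rewrite /power_map fmap_id.
- by move=> A B D f g x; apply/funext => i; rewrite /power_map fmap_comp.
Defined.

Section Sub.
Variables (F : cfunctor k) (P : forall A : comAlgType k, F A -> Prop).
Hypothesis stable : forall (A B : comAlgType k) (f : {lrmorphism A -> B})
  (x : F A), P x -> P (fmap F f x).

Definition sub_map (A B : comAlgType k) (f : {lrmorphism A -> B})
    (x : {x : F A | P x}) : {x : F B | P x} :=
  exist (@P B) (fmap F f (sval x)) (stable f (svalP x)).

Definition subfunctor : cfunctor k.
Proof.
refine (@CFunctor k (fun A => {x : F A | P x}) sub_map _ _).
- by move=> A [x Px]; apply: eq_exist; rewrite fmap_id.
- by move=> A B D f g [x Px]; apply: eq_exist; rewrite /= fmap_comp.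
Defined.
End Sub.

Section Fibre.
Variables (F : cfunctor k) (pi : fmorphism F A1) (c : k).

Definition in_fibre (A : comAlgType k) (x : F A) : Prop := pi A x = c%:A.

Lemma in_fibre_stable (A B : comAlgType k) (f : {lrmorphism A -> B}) (x : F A) :
  in_fibre x -> in_fibre (fmap F f x).
Proof. by rewrite /in_fibre natural => ->; exact: rmorph_alg. Qed.

Definition fibre : cfunctor k := subfunctor in_fibre_stable.
End Fibre.

End Constructions.

(* The projective line: P^1(A) is the set of direct summands of rank 1 of A^2;
   [a1 : a2] is the line generated by a unimodular vector (a1, a2). *)

Definition submodule (A : comNzRingType) (N : set 'rV[A]_2) : Prop :=
  N 0 /\ forall (a : A) u v, N u -> N v -> N (a *: u + v).

Definition submod_span (A : comNzRingType) (S : set 'rV[A]_2) : set 'rV[A]_2 :=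
  smallest (@submodule A) S.

Definition base_change (A B : comNzRingType) (f : {rmorphism A -> B})
    (L : set 'rV[A]_2) : set 'rV[B]_2 :=
  submod_span [set map_mx f v | v in L].

Definition direct_summand (A : comNzRingType) (L : set 'rV[A]_2) : Prop :=
  submodule L /\ exists M : set 'rV[A]_2,
    [/\ submodule M,
        forall v, exists l m, [/\ L l, M m & v = l + m]
      & forall v, L v -> M v -> v = 0].

(* For a direct summand L, the image of L \otimes K in K^2 is L \otimes K
   itself, so this says that L has dimension 1 at every field-valued point. *)
Definition rank1 (A : comNzRingType) (L : set 'rV[A]_2) : Prop :=
  forall (K : fieldType) (f : {rmorphism A -> K}),
    exists2 w : 'rV[K]_2, w != 0 &
      base_change f L = [set c *: w | c in [set: K]].

Definition is_line (A : comNzRingType) (L : set 'rV[A]_2) : Prop :=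
  direct_summand L /\ rank1 L.

Section Span.
Variable A : comNzRingType.
Implicit Types (S N : set 'rV[A]_2).

Lemma submodule_span S : submodule (submod_span S).
Proof.
split=> [N [[]]//|a u v Su Sv N [smN SN]].
by case: (smN) => _; apply; [exact: Su|exact: Sv].
Qed.

Lemma subset_submod_span S : S `<=` submod_span S.
Proof. by move=> v Sv N [_]; apply. Qed.

Lemma submod_span_min S N : submodule N -> S `<=` N -> submod_span S `<=` N.
Proof. by move=> smN SN v; apply. Qed.

Lemma submod_span_id S : submodule S -> submod_span S = S.
Proof.
move=> smS; apply/seteqP; split; first exact: submod_span_min.
exact: subset_submod_span.
Qed.

Lemma linear_submod_span S (F : 'rV[A]_2 -> A) :
  (forall a u v, F (a *: u + v) = a * F u + F v) ->
  (forall v, S v -> F v = 0) -> forall v, submod_span S v -> F v = 0.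
Proof.
move=> linF F0; apply: submod_span_min => //; split=> [|a u v /= u0 v0].
- by have := linF (-1) 0 0; rewrite scaler0 addr0 mulN1r addNr.
- by rewrite linF u0 v0 mulr0 addr0.
Qed.

Lemma submoduleD N u v : submodule N -> N u -> N v -> N (u + v).
Proof. by move=> [_ cN] Nu Nv; rewrite -[u]scale1r; exact: cN. Qed.

Lemma submoduleZ N a u : submodule N -> N u -> N (a *: u).
Proof. by move=> [N0 cN] Nu; rewrite -[_ *: _]addr0; exact: cN. Qed.

Lemma submodule_mul N (M : 'M[A]_2) v :
  submodule N -> (forall i, N (row i M)) -> N (v *m M).
Proof.
move=> smN NM; rewrite mulmx_sum_row; apply: (big_ind N).
- by case: smN.
- by move=> *; exact: submoduleD.
- by move=> i _; exact: submoduleZ.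
Qed.
End Span.

Section BaseChange.

Lemma submodule_preim (A B : comNzRingType) (f : {rmorphism A -> B})
    (N : set 'rV[B]_2) : submodule N -> submodule [set v | N (map_mx f v)].
Proof.
move=> [N0 cN]; split=> /=; first by rewrite map_mx0.
by move=> a u v Nu Nv; rewrite map_mxD map_mxZ; exact: cN.
Qed.

Lemma base_change_span (A B : comNzRingType) (f : {rmorphism A -> B})
    (S : set 'rV[A]_2) : base_change f (submod_span S) = base_change f S.
Proof.
apply/seteqP; split; apply: submod_span_min; try exact: submodule_span.
- move=> _ [v Sv <-].
  have smN := submodule_preim f (submodule_span [set map_mx f u | u in S]).
  apply: (submod_span_min smN) v Sv => v Sv /=.
  by apply: subset_submod_span; exists v.
- move=> _ [v Sv <-]; apply: subset_submod_span; exists v => //.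
  exact: subset_submod_span.
Qed.

Lemma base_change_comp (A B D : comNzRingType) (f : {rmorphism A -> B})
    (g : {rmorphism B -> D}) (h : {rmorphism A -> D}) (L : set 'rV[A]_2) :
  h =1 g \o f -> base_change h L = base_change g (base_change f L).
Proof.
move=> hE; rewrite [base_change f L]/base_change base_change_span /base_change.
congr submod_span; apply/seteqP; split=> v.
- move=> [u Lu <-]; exists (map_mx f u); first by exists u.
  by apply/matrixP => i j; rewrite !mxE hE.
- move=> [_ [u Lu <-] <-]; exists u => //.
  by apply/matrixP => i j; rewrite !mxE hE.
Qed.

Lemma base_change_id (A : comNzRingType) (f : {rmorphism A -> A})
    (L : set 'rV[A]_2) : f =1 id -> submodule L -> base_change f L = L.
Proof.
move=> fE smL; rewrite -[RHS]submod_span_id // /base_change; congr submod_span.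
apply/seteqP; split=> v; last by move=> Lv; exists v => //; exact: map_mx_id.
by move=> [u Lu <-]; rewrite map_mx_id.
Qed.

Lemma base_change_summand (A B : comNzRingType) (f : {rmorphism A -> B})
    (L : set 'rV[A]_2) : direct_summand L -> direct_summand (base_change f L).
Proof.
move=> [smL [M [smM LM L0]]]; split; first exact: submodule_span.
have /choice [l /choice [m lm]] : forall i : 'I_2, exists l, exists m,
    [/\ L l, M m & delta_mx 0 i = l + m] by move=> i; exact: LM.
pose Q := \matrix_(i < 2) l i; pose T := \matrix_(i < 2) m i.
have QT1 : Q + T = 1%:M.
  apply/row_matrixP => i; rewrite raddfD /= !rowK row1.
  by case: (lm i) => _ _ ->.
have vE v : v = v *m Q + v *m T by rewrite -mulmxDr QT1 mulmx1.
have LQ v : L (v *m Q).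
  by apply: submodule_mul => // i; rewrite rowK; case: (lm i).
have MT v : M (v *m T).
  by apply: submodule_mul => // i; rewrite rowK; case: (lm i).
have LT v : L v -> v *m T = 0.
  move=> Lv; apply: L0 => //.
  have -> : v *m T = (-1) *: (v *m Q) + v.
    by rewrite [X in _ = _ + X]vE scaleN1r addKr.
  by case: smL => _; apply.
have MQ v : M v -> v *m Q = 0.
  move=> Mv; apply: L0 => //.
  have -> : v *m Q = (-1) *: (v *m T) + v.
    by rewrite [X in _ = _ + X]vE scaleN1r addrC addrK.
  by case: smM => _; apply.
have kermx_sub (X : 'M[B]_2) : submodule [set v : 'rV[B]_2 | v *m X = 0].
  split=> [|a u v /= u0 v0]; first by rewrite /= mul0mx.
  by rewrite mulmxDl -scalemxAl u0 v0 scaler0 addr0.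
have fLT v : base_change f L v -> v *m map_mx f T = 0.
  apply: (submod_span_min (kermx_sub _)) => _ [u Lu <-] /=.
  by rewrite -map_mxM LT // map_mx0.
have fMQ v : base_change f M v -> v *m map_mx f Q = 0.
  apply: (submod_span_min (kermx_sub _)) => _ [u Mu <-] /=.
  by rewrite -map_mxM MQ // map_mx0.
have fvE v : v = v *m map_mx f Q + v *m map_mx f T.
  by rewrite -mulmxDr -map_mxD QT1 map_mx1 mulmx1.
exists (base_change f M); split; first exact: submodule_span.
- move=> v; exists (v *m map_mx f Q), (v *m map_mx f T); split=> //.
  + apply: submodule_mul => [|i]; first exact: submodule_span.
    rewrite -map_row rowK; apply: subset_submod_span; exists (l i) => //.
    by case: (lm i).
  + apply: submodule_mul => [|i]; first exact: submodule_span.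
    rewrite -map_row rowK; apply: subset_submod_span; exists (m i) => //.
    by case: (lm i).
  + exact: fvE.
- by move=> v Lv Mv; rewrite [v]fvE fLT // fMQ // addr0.
Qed.

Lemma base_change_line (A B : comNzRingType) (f : {rmorphism A -> B})
    (L : set 'rV[A]_2) : is_line L -> is_line (base_change f L).
Proof.
move=> [dsL rkL]; split; first exact: base_change_summand.
move=> K g; have [w w0 wE] := rkL K (g \o f : {rmorphism A -> K}).
by exists w => //; rewrite -wE; apply/esym/base_change_comp.
Qed.
End BaseChange.

Section ProjectiveLine.
Variable k : fieldType.

Record P1_point (A : comAlgType k) := P1Point {
  line :> set 'rV[A]_2;
  lineP : is_line line
}.

Lemma P1_inj (A : comAlgType k) (a b : P1_point A) : line a = line b -> a = b.
Proof.
case: a b => [L LP] [M MP] /= LM; case: _ / LM in MP *.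
by rewrite (Prop_irrelevance LP MP).
Qed.

Definition P1_map (A B : comAlgType k) (f : {lrmorphism A -> B})
    (a : P1_point A) : P1_point B :=
  P1Point (base_change_line f (lineP a)).

Definition P1 : cfunctor k.
Proof.
refine (@CFunctor k P1_point P1_map _ _).
- move=> A [L LP]; apply: P1_inj => /=; apply: base_change_id => //.
  by case: LP => [[]].
- by move=> A B D f g a; apply: P1_inj; exact: base_change_comp.
Defined.
End ProjectiveLine.

(* Homogeneous coordinates of a vector. *)
Notation "v `1" := (v (0 : 'I_1) (0 : 'I_2)) (at level 2, format "v `1").
Notation "v `2" := (v (0 : 'I_1) (1 : 'I_2)) (at level 2, format "v `2").

Definition vec2 (A : comNzRingType) (a b : A) : 'rV[A]_2 :=
  \row_j (if j == 0 then a else b).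

(* For a = [a1 : a2], the line of a^-1 = [a2 : a1]. *)
Definition inv_line (A : comNzRingType) (L : set 'rV[A]_2) : set 'rV[A]_2 :=
  [set vec2 v`2 v`1 | v in L].

(* For a = [a1 : a2], the line of 1 - e a = [a2 - e a1 : a2]. *)
Definition one_minus_line (A : comNzRingType) (e : A) (L : set 'rV[A]_2) :
    set 'rV[A]_2 :=
  [set vec2 (v`2 - e * v`1) v`2 | v in L].

(* For a = [a1 : a2], the line of (a - e) / a = [a1 - e a2 : a1]. *)
Definition sub_div_line (A : comNzRingType) (e : A) (L : set 'rV[A]_2) :
    set 'rV[A]_2 :=
  [set vec2 (v`1 - e * v`2) v`1 | v in L].

Definition pairs (n : nat) := {ij : 'I_n * 'I_n | ij.1 != ij.2}.

Definition mkpair n (i j : 'I_n) (ij : i != j) : pairs n :=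
  exist (fun p : 'I_n * 'I_n => p.1 != p.2) (i, j) ij.

(* A multihomogeneous equation holds at a tuple of lines when it holds for all
   vectors of these lines: it is a section of a tensor product of dual
   tautological bundles, which vanishes iff it vanishes on pure tensors. *)
Section Equations.
Variables (k : fieldType) (n : nat).

Definition LosevManin_eqs (A : comAlgType k)
    (al : power (P1 k) (pairs n) A) : Prop :=
  (forall (i j l : 'I_n) (ij : i != j) (jl : j != l) (il : i != l) a b c,
     line (al (mkpair ij)) a -> line (al (mkpair jl)) b ->
     line (al (mkpair il)) c ->
     a`1 * b`1 * c`2 = c`1 * a`2 * b`2) /\
  (forall (i j : 'I_n) (ij : i != j) (ji : j != i) a b,
     line (al (mkpair ij)) a -> line (al (mkpair ji)) b ->
     a`1 * b`1 = a`2 * b`2).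

Definition family_eqs (A : comAlgType k)
    (x : fprodc (power (P1 k) (pairs n)) (A1 k) A) : Prop :=
  let: (nu, e) := x in
  (forall (i j l : 'I_n) (ij : i != j) (jl : j != l) (il : i != l) a b c,
     line (nu (mkpair ij)) a -> line (nu (mkpair jl)) b ->
     line (nu (mkpair il)) c ->
     e * c`1 * a`2 * b`2 + a`1 * b`1 * c`2
       = c`1 * b`1 * a`2 + a`1 * c`1 * b`2) /\
  (forall (i j : 'I_n) (ij : i != j) (ji : j != i) a b,
     line (nu (mkpair ij)) a -> line (nu (mkpair ji)) b ->
     a`1 * b`2 + b`1 * a`2 = e * a`2 * b`2).

Lemma LosevManin_stable (A B : comAlgType k) (f : {lrmorphism A -> B})
    (al : power (P1 k) (pairs n) A) :
  LosevManin_eqs al -> LosevManin_eqs (fmap _ f al).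
Proof.
move=> [E1 E2]; split.
- move=> i j l ij jl il a b c La Lb Lc; apply: subr0_eq.
  move: a La; apply: linear_submod_span => [d u v|_ [a La <-]].
    by rewrite !mxE; ring.
  move: b Lb; apply: linear_submod_span => [d u v|_ [b Lb <-]].
    by rewrite !mxE; ring.
  move: c Lc; apply: linear_submod_span => [d u v|_ [c Lc <-]].
    by rewrite !mxE; ring.
  by rewrite !mxE -!rmorphM (E1 _ _ _ _ _ _ _ _ _ La Lb Lc) subrr.
- move=> i j ij ji a b La Lb; apply: subr0_eq.
  move: a La; apply: linear_submod_span => [d u v|_ [a La <-]].
    by rewrite !mxE; ring.
  move: b Lb; apply: linear_submod_span => [d u v|_ [b Lb <-]].
    by rewrite !mxE; ring.
  by rewrite !mxE -!rmorphM (E2 _ _ _ _ _ _ La Lb) subrr.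
Qed.

Lemma family_stable (A B : comAlgType k) (f : {lrmorphism A -> B})
    (x : fprodc (power (P1 k) (pairs n)) (A1 k) A) :
  family_eqs x -> family_eqs (fmap _ f x).
Proof.
case: x => nu e [E1 E2]; split.
- move=> i j l ij jl il a b c La Lb Lc; apply: subr0_eq.
  move: a La; apply: linear_submod_span => [d u v|_ [a La <-]].
    by rewrite !mxE; ring.
  move: b Lb; apply: linear_submod_span => [d u v|_ [b Lb <-]].
    by rewrite !mxE; ring.
  move: c Lc; apply: linear_submod_span => [d u v|_ [c Lc <-]].
    by rewrite !mxE; ring.
  rewrite !mxE /A1_map -!rmorphM -!rmorphD.
  by rewrite (E1 _ _ _ _ _ _ _ _ _ La Lb Lc) subrr.
- move=> i j ij ji a b La Lb; apply: subr0_eq.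
  move: a La; apply: linear_submod_span => [d u v|_ [a La <-]].
    by rewrite !mxE; ring.
  move: b Lb; apply: linear_submod_span => [d u v|_ [b Lb <-]].
    by rewrite !mxE; ring.
  rewrite !mxE /A1_map -!rmorphM -!rmorphD.
  by rewrite (E2 _ _ _ _ _ _ La Lb) subrr.
Qed.

Definition LosevManin : cfunctor k := subfunctor LosevManin_stable.

Definition family : cfunctor k := subfunctor family_stable.

Definition family_to_A1 : fmorphism family (A1 k).
Proof.
by refine (@FMorphism k family (A1 k) (fun A x => (sval x).2) _).
Defined.

Definition alpha (A : comAlgType k) (x : LosevManin A) (p : pairs n) :
    set 'rV[A]_2 :=
  line (sval x p).

Definition nu (eps : k) (A : comAlgType k) (x : fibre family_to_A1 eps A)
    (p : pairs n) : set 'rV[A]_2 :=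
  line ((sval (sval x)).1 p).

Definition delta (eps : k) (A : comAlgType k) (x : fibre family_to_A1 eps A)
    (p : pairs n) : set 'rV[A]_2 :=
  inv_line (nu x p).
End Equations.
Arguments family_to_A1 : clear implicits.

(* Main.v *)
Require Import Defs.
From mathcomp Require Import all_boot all_algebra complex ring.
From mathcomp Require Import boolp classical_sets reals.
Import GRing.Theory.
Local Open Scope ring_scope.

(** For [eps != 0] the rule [alpha = (nu - eps) / nu], that is
    [(x1 : x2) |-> (x1 - eps x2 : x1)], is a projective transformation of the
    line: its matrix [mobius eps] has determinant [eps].  Applied to every
    coordinate, it is an automorphism of the power of P^1, and it only remains
    to see that it exchanges the two systems of equations.  Substituting
    [a1 = x1 - eps x2] and [a2 = x1], and likewise for the other coordinates,
    each Losev-Manin equation becomes plus or minus [eps] times the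
    corresponding equation of the family, and [eps] is invertible
    ([multiplicativity_mobius], [inversion_mobius]).

    On points with values in an algebra, an invertible matrix acts on lines by
    taking images ([mx_line]).  The image of a line is again a line, and taking
    images commutes with base change ([is_line_mx], [base_change_mx]), so the
    action is an endomorphism [P1_mx] of the functor P^1. *)

(** * The action of invertible matrices on lines *)

Section LineAction.
Set Implicit Arguments.
Unset Strict Implicit.
Unset Printing Implicit Defensive.
Local Open Scope classical_set_scope.

(** The image of a submodule of [A^2] under a matrix acting on row vectors. *)
Definition mx_line (A : comNzRingType) (M : 'M[A]_2) (L : set 'rV[A]_2) :
    set 'rV[A]_2 :=
  [set v *m M | v in L].

Lemma mx_lineK (A : comNzRingType) (M N : 'M[A]_2) (L : set 'rV[A]_2) :
  M *m N = 1%:M -> mx_line N (mx_line M L) = L.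
Proof.
move=> MN; apply/seteqP; split=> v.
  by move=> [_ [u Lu <-] <-]; rewrite -mulmxA MN mulmx1.
move=> Lv; exists (v *m M); first by exists v.
by rewrite -mulmxA MN mulmx1.
Qed.

Lemma submodule_mx (A : comNzRingType) (M : 'M[A]_2) (L : set 'rV[A]_2) :
  submodule L -> submodule (mx_line M L).
Proof.
move=> [L0 cL]; split; first by exists 0 => //; rewrite mul0mx.
move=> a _ _ [u Lu <-] [v Lv <-]; exists (a *: u + v); first exact: cL.
by rewrite mulmxDl scalemxAl.
Qed.

Lemma base_change_mx (A B : comNzRingType) (f : {rmorphism A -> B})
    (M : 'M[A]_2) (L : set 'rV[A]_2) :
  base_change f (mx_line M L) = mx_line (map_mx f M) (base_change f L).
Proof.
apply/seteqP; split.
  apply: submod_span_min; first exact/submodule_mx/submodule_span.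
  move=> _ [_ [v Lv <-] <-]; exists (map_mx f v); last by rewrite map_mxM.
  by apply: subset_submod_span; exists v.
move=> _ [v Lv <-]; move: v Lv.
apply: (@submod_span_min _ _
  [set v | base_change f (mx_line M L) (v *m map_mx f M)]).
  have [S0 cS] := submodule_span [set map_mx f v | v in mx_line M L].
  split=> [|a u v /= Su Sv]; first by rewrite /= mul0mx.
  by rewrite mulmxDl -scalemxAl; exact: cS.
move=> _ [v Lv <-] /=; rewrite -map_mxM; apply: subset_submod_span.
by exists (v *m M) => //; exists v.
Qed.

Lemma direct_summand_mx (A : comNzRingType) (M N : 'M[A]_2)
    (L : set 'rV[A]_2) :
  M *m N = 1%:M -> direct_summand L -> direct_summand (mx_line M L).
Proof.
move=> MN [smL [C [smC LC L0]]]; split; first exact: submodule_mx.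
exists (mx_line M C); split; first exact: submodule_mx.
  move=> v; have [l [c [Ll Cc vE]]] := LC (v *m N).
  exists (l *m M), (c *m M); split; [by exists l|by exists c|].
  by rewrite -mulmxDl -vE -mulmxA (mulmx1C MN) mulmx1.
move=> _ [u Lu <-] [w Cw wu].
have /(congr1 (mulmx^~ N)) := wu; rewrite -!mulmxA MN !mulmx1 => wE.
by rewrite (L0 u) ?mul0mx // -wE.
Qed.

Lemma is_line_mx (A : comNzRingType) (M N : 'M[A]_2) (L : set 'rV[A]_2) :
  M *m N = 1%:M -> is_line L -> is_line (mx_line M L).
Proof.
move=> MN [dsL rkL]; split; first exact: direct_summand_mx MN dsL.
move=> K f; have [w w0 wE] := rkL K f.
have fMN : map_mx f M *m map_mx f N = 1%:M by rewrite -map_mxM MN map_mx1.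
exists (w *m map_mx f M).
  apply: contra_neq w0 => /(congr1 (mulmx^~ (map_mx f N))).
  by rewrite -mulmxA fMN mulmx1 mul0mx.
rewrite base_change_mx wE; apply/seteqP; split=> v.
  by move=> [_ [c _ <-] <-]; exists c => //; rewrite scalemxAl.
by move=> [c _ <-]; exists (c *: w); [exists c|rewrite scalemxAl].
Qed.

End LineAction.

(** * Projective transformations of the functor P^1 *)

Section ProjectiveAction.
Set Implicit Arguments.
Unset Strict Implicit.
Unset Printing Implicit Defensive.
Variable k : fieldType.

Lemma map_mx_alg (A B : comAlgType k) (f : {lrmorphism A -> B}) (M : 'M[k]_2) :
  map_mx f (map_mx (in_alg A) M) = map_mx (in_alg B) M.
Proof. by apply/matrixP => i j; rewrite !mxE rmorph_alg. Qed.

Lemma map_mx_alg1 (A : comAlgType k) (M N : 'M[k]_2) :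
  M *m N = 1%:M -> map_mx (in_alg A) M *m map_mx (in_alg A) N = 1%:M.
Proof. by move=> MN; rewrite -map_mxM MN map_mx1. Qed.

(** The projective transformation of P^1 given by a matrix over the base field;
    the second matrix witnesses that the first one is invertible. *)
Definition P1_mx_point (M N : 'M[k]_2) (MN : M *m N = 1%:M) (A : comAlgType k)
    (a : P1 k A) : P1 k A :=
  P1Point (is_line_mx (map_mx_alg1 A MN) (lineP a)).

Lemma P1_mx_natural (M N : 'M[k]_2) (MN : M *m N = 1%:M) (A B : comAlgType k)
    (f : {lrmorphism A -> B}) (a : P1 k A) :
  P1_mx_point MN (P1_map f a) = P1_map f (P1_mx_point MN a).
Proof. by apply: P1_inj; rewrite /= base_change_mx map_mx_alg. Qed.

Definition P1_mx (M N : 'M[k]_2) (MN : M *m N = 1%:M) :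
  fmorphism (P1 k) (P1 k) := FMorphism (P1_mx_natural MN).

Lemma P1_mxK (M N : 'M[k]_2) (MN : M *m N = 1%:M) (NM : N *m M = 1%:M)
    (A : comAlgType k) : cancel (P1_mx MN A) (P1_mx NM A).
Proof. by move=> a; apply: P1_inj; exact/mx_lineK/map_mx_alg1. Qed.

End ProjectiveAction.

(** * The transformation taking nu to (nu - e) / nu, and the equations *)

Section Mobius.
Set Implicit Arguments.
Unset Strict Implicit.
Unset Printing Implicit Defensive.

(** The matrix of [(x1 : x2) |-> (x1 - e x2 : x1)], for row vectors. *)
Definition mobius (A : comNzRingType) (e : A) : 'M[A]_2 :=
  \matrix_(i, j) (if i == 0 then 1 else if j == 0 then - e else 0).

(** The matrix of [(a1 : a2) |-> (a2 : (a2 - a1) / e)], with [d] the inverse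
    of [e]. *)
Definition mobius_inv (A : comNzRingType) (d : A) : 'M[A]_2 :=
  \matrix_(i, j) (if i == 0 then (if j == 0 then 0 else - d)
                  else (if j == 0 then 1 else d)).

Lemma mobiusK (A : comNzRingType) (e d : A) :
  e * d = 1 -> mobius e *m mobius_inv d = 1%:M.
Proof.
move=> ed; apply/matrixP => i j; rewrite !mxE !big_ord_recl big_ord0 !mxE /=.
case: i j => [[|[|//]] ?] [[|[|//]] ?] /=; rewrite ?mulrNN ?ed; ring.
Qed.

Lemma map_mobius (A B : comNzRingType) (f : {rmorphism A -> B}) (e : A) :
  map_mx f (mobius e) = mobius (f e).
Proof.
apply/matrixP => i j; rewrite !mxE.
by do !case: ifP => _; rewrite ?rmorph1 ?rmorphN ?rmorph0.
Qed.

Lemma mul_mobius (A : comNzRingType) (e : A) (v : 'rV[A]_2) :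
  v *m mobius e = vec2 (v`1 - e * v`2) v`1.
Proof.
apply/rowP => j; rewrite !mxE !big_ord_recl big_ord0 !mxE /=.
have -> : lift 0 0 = 1 :> 'I_2 by apply: val_inj.
by case: ifP => _; ring.
Qed.

Lemma mx_line_mobius (A : comNzRingType) (e : A) (L : set 'rV[A]_2) :
  mx_line (mobius e) L = sub_div_line e L.
Proof. by congr image; apply/funext => v; exact: mul_mobius. Qed.

Lemma one_minus_inv_line (A : comNzRingType) (e : A) (L : set 'rV[A]_2) :
  one_minus_line e (inv_line L) = sub_div_line e L.
Proof.
apply/seteqP; split=> v.
  by move=> [_ [u Lu <-] <-]; exists u => //; rewrite !mxE.
move=> [u Lu <-]; exists (vec2 u`2 u`1); first by exists u.
by rewrite !mxE.
Qed.

Lemma mul_invertible_eq0 (A : comNzRingType) (e d u : A) :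
  e * d = 1 -> e * u = 0 -> u = 0.
Proof. by move=> ed eu; rewrite -[u]mul1r -ed mulrAC eu mul0r. Qed.

(** The difference of the two sides of the left-hand equation is [e] times the
    difference of the two sides of the right-hand one. *)
Lemma multiplicativity_mobius (A : comNzRingType) (e d : A) (x y z : 'rV[A]_2) :
  e * d = 1 ->
  let a := x *m mobius e in let b := y *m mobius e in
  let c := z *m mobius e in
  a`1 * b`1 * c`2 = c`1 * a`2 * b`2 <->
  e * z`1 * x`2 * y`2 + x`1 * y`1 * z`2
    = z`1 * y`1 * x`2 + x`1 * z`1 * y`2.
Proof.
move=> ed /=; rewrite !mul_mobius !mxE /=; split=> E; apply: subr0_eq.
  apply: (mul_invertible_eq0 ed).
  by move/eqP: E; rewrite -subr_eq0 => /eqP <-; ring.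
rewrite -[RHS](mulr0 e).
by move/eqP: E; rewrite -subr_eq0 => /eqP <-; ring.
Qed.

(** Here the two differences are related by the factor [- e]. *)
Lemma inversion_mobius (A : comNzRingType) (e d : A) (x y : 'rV[A]_2) :
  e * d = 1 ->
  let a := x *m mobius e in let b := y *m mobius e in
  a`1 * b`1 = a`2 * b`2 <-> x`1 * y`2 + y`1 * x`2 = e * x`2 * y`2.
Proof.
move=> ed /=; rewrite !mul_mobius !mxE /=; split=> E; apply: subr0_eq.
  apply: (mul_invertible_eq0 ed); apply: oppr_inj; rewrite oppr0.
  by move/eqP: E; rewrite -subr_eq0 => /eqP <-; ring.
rewrite -[RHS](mulr0 (- e)).
by move/eqP: E; rewrite -subr_eq0 => /eqP <-; ring.
Qed.

End Mobius.

(** * The isomorphism of the fibre with the Losev-Manin space *)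

Section FibreIso.
Set Implicit Arguments.
Unset Strict Implicit.
Unset Printing Implicit Defensive.
Variables (k : fieldType) (n : nat) (eps : k).
Hypothesis eps0 : eps != 0.

Let MN : mobius eps *m mobius_inv eps^-1 = 1%:M := mobiusK (mulfV eps0).
Let NM : mobius_inv eps^-1 *m mobius eps = 1%:M := mulmx1C MN.

Lemma line_P1_mobius (A : comAlgType k) (a : P1 k A) :
  line (P1_mx MN A a) = mx_line (mobius eps%:A) (line a).
Proof. by rewrite /= map_mobius. Qed.

(** The transformation of all coordinates identifies the two systems of
    equations; this single equivalence serves both directions of the
    isomorphism. *)
Lemma LosevManin_mobius (A : comAlgType k) (nu : power (P1 k) (pairs n) A) :
  LosevManin_eqs (fun p => P1_mx MN A (nu p)) <-> family_eqs (nu, eps%:A).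
Proof.
have ed : (eps%:A : A) * (eps^-1)%:A = 1.
  by rewrite -(rmorphM (in_alg A)) mulfV // rmorph1.
split=> -[E1 E2]; split.
- move=> i j l ij jl il a b c La Lb Lc.
  apply/(multiplicativity_mobius a b c ed)/(E1 i j l ij jl il).
  + by rewrite line_P1_mobius; exists a.
  + by rewrite line_P1_mobius; exists b.
  + by rewrite line_P1_mobius; exists c.
- move=> i j ij ji a b La Lb.
  apply/(inversion_mobius a b ed)/(E2 i j ij ji).
  + by rewrite line_P1_mobius; exists a.
  + by rewrite line_P1_mobius; exists b.
- move=> i j l ij jl il a' b' c'; rewrite !line_P1_mobius.
  move=> [a La <-] [b Lb <-] [c Lc <-].
  exact/(multiplicativity_mobius a b c ed)/(E1 i j l ij jl il).
- move=> i j ij ji a' b'; rewrite !line_P1_mobius.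
  move=> [a La <-] [b Lb <-].
  exact/(inversion_mobius a b ed)/(E2 i j ij ji).
Qed.

Let Fib := fibre (family_to_A1 k n) eps.

Lemma fibre_eqs (A : comAlgType k) (x : Fib A) :
  LosevManin_eqs (fun p => P1_mx MN A ((sval (sval x)).1 p)).
Proof.
case: x => -[[nu e] E] eE.
have e_eps : e = eps%:A := eE.
by apply: (LosevManin_mobius nu).2; rewrite -e_eps.
Qed.

Definition fibre_to_LosevManin_point (A : comAlgType k) (x : Fib A) :
    LosevManin k n A :=
  exist _ _ (fibre_eqs x).

Lemma fibre_to_LosevManin_natural (A B : comAlgType k)
    (f : {lrmorphism A -> B}) (x : Fib A) :
  fibre_to_LosevManin_point (fmap Fib f x)
    = fmap (LosevManin k n) f (fibre_to_LosevManin_point x).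
Proof.
case: x => -[[nu e] E] eE; apply: eq_exist; apply/funext => p /=.
exact: P1_mx_natural.
Qed.

(** The morphism [alpha = (nu - eps) / nu] in every coordinate. *)
Definition fibre_to_LosevManin : fmorphism Fib (LosevManin k n) :=
  FMorphism fibre_to_LosevManin_natural.

Lemma LosevManin_family_eqs (A : comAlgType k) (x : LosevManin k n A) :
  family_eqs ((fun p => P1_mx NM A (sval x p)) : power (P1 k) (pairs n) A,
              eps%:A).
Proof.
apply: (LosevManin_mobius _).1.
have -> : (fun p => P1_mx MN A (P1_mx NM A (sval x p))) = sval x.
  by apply/funext => p; exact: P1_mxK.
exact: (svalP x).
Qed.

Definition LosevManin_to_fibre_point (A : comAlgType k)
    (x : LosevManin k n A) : Fib A :=
  exist (fun y : Defs.family k n A => in_fibre (family_to_A1 k n) eps y)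
    (exist _ _ (LosevManin_family_eqs x)) erefl.

Lemma LosevManin_to_fibre_natural (A B : comAlgType k)
    (f : {lrmorphism A -> B}) (x : LosevManin k n A) :
  LosevManin_to_fibre_point (fmap (LosevManin k n) f x)
    = fmap Fib f (LosevManin_to_fibre_point x).
Proof.
case: x => al E; do 2!apply: eq_exist; congr pair.
  by apply/funext => p /=; exact: P1_mx_natural.
exact/esym/rmorph_alg.
Qed.

(** The inverse, [nu = eps / (1 - alpha)] in every coordinate. *)
Definition LosevManin_to_fibre : fmorphism (LosevManin k n) Fib :=
  FMorphism LosevManin_to_fibre_natural.

Lemma fibre_to_LosevManinK (A : comAlgType k) :
  cancel (fibre_to_LosevManin A) (LosevManin_to_fibre A).
Proof.
move=> [[[nu e] E] eE]; do 2!apply: eq_exist; congr pair; last exact: esym eE.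
by apply/funext => p; exact: P1_mxK.
Qed.

Lemma LosevManin_to_fibreK (A : comAlgType k) :
  cancel (LosevManin_to_fibre A) (fibre_to_LosevManin A).
Proof.
by move=> [al E]; apply: eq_exist; apply/funext => p; exact: P1_mxK.
Qed.

End FibreIso.

Theorem proposition3p16 (R : realType) (n : nat) (eps : R[i]) (heps : eps != 0) :
  exists f : fmorphism (fibre (family_to_A1 R[i] n) eps) (LosevManin R[i] n),
    is_iso f /\
    forall (A : comAlgType R[i]) (x : fibre (family_to_A1 R[i] n) eps A)
      (p : pairs n),
      alpha (f A x) p = one_minus_line eps%:A (delta x p) /\
      alpha (f A x) p = sub_div_line eps%:A (nu x p).
Proof.
exists (fibre_to_LosevManin n heps); split.
  exists (LosevManin_to_fibre n heps).
  by split=> A; [exact: fibre_to_LosevManinK|exact: LosevManin_to_fibreK].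
move=> A x p; rewrite /delta one_minus_inv_line -mx_line_mobius.
by split; exact: line_P1_mobius.
Qed.
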